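(* Let $n=2^k$ with $k\ge4$ an integer, and let $\mathbb{R}^n$ carry the Euclidean norm. Then $C(\mathbb{R}^n)=\log_2 n$.
   Context: For a finite-dimensional normed space $X$, $C(X)$ is the least constant such that $\mathcal{H}(A,\operatorname{Co}(A))\le C(X)\sup_{t\in[0,1]}\mathcal{H}(tA+(1-t)A,A)$ for all nonempty $A\subseteq X$; equivalently, $C(X)=\sup\{\mathcal{H}(A,\operatorname{Co}(A)): A\subseteq X \text{ approximately convex}\}$, where $A$ is approximately convex if $d(tx+(1-t)y,A)\le1$ for all $x,y\in A$, $t\in[0,1]$. Here $d(x,A)=\inf_{a\in A}\|x-a\|$, $\mathcal{H}$ is the Hausdorff distance and $\operatorname{Co}$ the convex hull. *)

(* Defs.v *)
From HB Require Import structures.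
From mathcomp Require Import all_boot all_order all_algebra.
From mathcomp Require Import all_classical all_reals all_analysis.
Set Implicit Arguments. Unset Strict Implicit. Unset Printing Implicit Defensive.
Import Order.TTheory GRing.Theory Num.Theory.
Local Open Scope classical_set_scope.
Local Open Scope ring_scope.

Section Defs.
Variables (R : realType) (n : nat).
Notation V := 'rV[R]_n.

Definition enorm (x : V) : R := Num.sqrt (\sum_(i < n) x ord0 i ^+ 2).

(* d(x, A) = inf_{a in A} ||x - a||  (= +oo for A empty) *)
Definition edist_set (x : V) (A : set V) : \bar R :=
  ereal_inf [set (enorm (x - a))%:E | a in A].

Definition hausdorff (A B : set V) : \bar R :=
  maxe (ereal_sup [set edist_set a B | a in A])
       (ereal_sup [set edist_set b A | b in B]).

Definition conv_hull (A : set V) : set V :=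
  [set x | exists (m : nat) (w : 'I_m -> R) (p : 'I_m -> V),
     (forall i, 0 <= w i) /\ \sum_(i < m) w i = 1 /\
     (forall i, A (p i)) /\ x = \sum_(i < m) w i *: p i].

Definition approx_convex (A : set V) : Prop :=
  forall x y, A x -> A y -> forall t : R, 0 <= t <= 1 ->
    (edist_set (t *: x + (1 - t) *: y) A <= 1%:E)%E.

Definition Cconst : \bar R :=
  ereal_sup [set hausdorff A (conv_hull A) |
             A in [set A : set V | A !=set0 /\ approx_convex A]].
End Defs.

(* Main.v *)
Require Import Defs.
From HB Require Import structures.
From mathcomp Require Import all_boot all_order all_algebra.
From mathcomp Require Import all_classical all_reals all_analysis.
From mathcomp Require Import zify ring lra.
Import Order.TTheory GRing.Theory Num.Theory.
Import numFieldNormedType.Exports.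
Local Open Scope classical_set_scope.
Local Open Scope ring_scope.

Set Implicit Arguments.
Unset Strict Implicit.
Unset Printing Implicit Defensive.

(** Upper bound. By iterated halving, a convex combination of [2 ^ k] points of
    [A] is within [k] of [A]. Caratheodory's theorem in dimension [n = 2 ^ k]
    only gives [n + 1] points, so maximise the distance to [A] over their
    simplex. If the maximum is attained on the boundary, [n] points suffice. If
    it is attained at an interior point [y], then [y] is a local maximum of the
    distance to [A] in the whole space, so two almost nearest points of [A] are
    seen from [y] under an angle of at least a right angle; their midpoint is
    much closer to [y] than they are, whence [d y <= d y / sqrt 2 + 1] up to a
    small error and [d y <= 4 <= k].

    Lower bound. The base 2 entropy [H] satisfies
    [H (t x + (1 - t) y) <= t H x + (1 - t) H y + 1], so its epigraph over the
    simplex with [n] vertices, placed in a hyperplane, is approximately convex.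
    The barycenter at height [0] lies in its convex hull. As
    [H x >= log2 n - c |x - b| ^ 2] near the barycenter [b], dilating the
    simplex horizontally makes the distance from that point to the epigraph
    equal to [H b = log2 n = k]. *)

(** * Inner product and Euclidean norm on row vectors *)

Section EuclideanNorm.
Variables (R : realType) (n : nat).
Implicit Types (x y : 'rV[R]_n) (a b : R).

Definition dotv x y : R := \sum_(i < n) x ord0 i * y ord0 i.

Lemma dotvC x y : dotv x y = dotv y x.
Proof. by apply: eq_bigr => i _; rewrite mulrC. Qed.

Lemma dotvDl x y z : dotv (x + y) z = dotv x z + dotv y z.
Proof. by rewrite -big_split; apply: eq_bigr => i _; rewrite mxE mulrDl. Qed.

Lemma dotvZl a x y : dotv (a *: x) y = a * dotv x y.
Proof. by rewrite mulr_sumr; apply: eq_bigr => i _; rewrite mxE mulrA. Qed.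

Lemma dotvDr x y z : dotv x (y + z) = dotv x y + dotv x z.
Proof. by rewrite dotvC dotvDl !(dotvC x). Qed.

Lemma dotvZr a x y : dotv x (a *: y) = a * dotv x y.
Proof. by rewrite dotvC dotvZl dotvC. Qed.

Lemma dotvv_ge0 x : 0 <= dotv x x.
Proof. by apply: sumr_ge0 => i _; rewrite -expr2 sqr_ge0. Qed.

Lemma dotvv_eq0 x : (dotv x x == 0) = (x == 0).
Proof.
apply/eqP/eqP => [h|->]; last by apply: big1 => i _; rewrite mxE mul0r.
apply/rowP => i; rewrite mxE.
have := psumr_eq0P _ h => /(_ _ i isT) hi.
apply/eqP; rewrite -sqrf_eq0 expr2; apply/eqP/hi => j _.
by rewrite -expr2 sqr_ge0.
Qed.

Lemma enorm_ge0 x : 0 <= enorm x.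
Proof. exact: sqrtr_ge0. Qed.

Lemma sqr_enorm x : enorm x ^+ 2 = dotv x x.
Proof.
rewrite /enorm sqr_sqrtr; first by apply: eq_bigr => i _; rewrite expr2.
by apply: sumr_ge0 => i _; exact: sqr_ge0.
Qed.

Lemma cauchy_schwarz_dotv x y : dotv x y ^+ 2 <= dotv x x * dotv y y.
Proof.
have [->|y0] := eqVneq y 0.
  by rewrite -(scale0r 0) !dotvZr !mul0r expr0n /= mulr0.
have c0 : 0 < dotv y y by rewrite lt0r dotvv_eq0 y0 dotvv_ge0.
have := dotvv_ge0 (dotv y y *: x + (- dotv x y) *: y).
rewrite !(dotvDl, dotvDr, dotvZl, dotvZr) (dotvC y x) => h.
rewrite -(ler_pM2l c0); nra.
Qed.

Lemma enormZ a x : enorm (a *: x) = `|a| * enorm x.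
Proof.
apply/eqP; rewrite -(@eqrXn2 _ 2) ?mulr_ge0 ?enorm_ge0 //.
by rewrite exprMn !sqr_enorm dotvZl dotvZr mulrA -expr2 real_normK ?num_real.
Qed.

Lemma enormN x : enorm (- x) = enorm x.
Proof. by rewrite -scaleN1r enormZ normrN1 mul1r. Qed.

Lemma enorm0 : enorm (0 : 'rV[R]_n) = 0.
Proof. by rewrite -(scale0r 0) enormZ normr0 mul0r. Qed.

Lemma enormD x y : enorm (x + y) <= enorm x + enorm y.
Proof.
rewrite -(@ler_pXn2r _ 2) ?nnegrE ?addr_ge0 ?enorm_ge0 //.
rewrite sqrrD !sqr_enorm dotvDl !dotvDr (dotvC y x).
have : dotv x y <= enorm x * enorm y.
  apply: (le_trans (ler_norm _)).
  rewrite -(@ler_pXn2r _ 2) ?nnegrE ?mulr_ge0 ?enorm_ge0 //.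
  by rewrite real_normK ?num_real // exprMn !sqr_enorm cauchy_schwarz_dotv.
by rewrite mulr2n; lra.
Qed.

Lemma enorm_sum m (F : 'I_m -> 'rV[R]_n) :
  enorm (\sum_(i < m) F i) <= \sum_(i < m) enorm (F i).
Proof.
elim/big_ind2: _ => [|x1 x2 y1 y2 h1 h2|//]; first by rewrite enorm0.
exact: le_trans (enormD _ _) (lerD h1 h2).
Qed.

End EuclideanNorm.

(** * Real-valued distance to a nonempty set *)

Section Distance.
Variables (R : realType) (n : nat) (A : set 'rV[R]_n).
Hypothesis A0 : A !=set0.
Implicit Types x y a : 'rV[R]_n.

Definition rdist x : R := inf [set enorm (x - a) | a in A].

Let has_lbound_dist x : has_lbound [set enorm (x - a) | a in A].
Proof. by exists 0 => _ [a _ <-]; exact: enorm_ge0. Qed.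

Let nonempty_dist x : [set enorm (x - a) | a in A] !=set0.
Proof. by case: A0 => a Aa; exists (enorm (x - a)), a. Qed.

Lemma edist_setE x : edist_set x A = (rdist x)%:E.
Proof. by rewrite -ereal_inf_EFin // image_comp. Qed.

Lemma rdist_le x a : A a -> rdist x <= enorm (x - a).
Proof. by move=> Aa; apply: ge_inf => //; exists a. Qed.

Lemma le_rdist x r : (forall a, A a -> r <= enorm (x - a)) -> r <= rdist x.
Proof. by move=> h; apply: lb_le_inf => // _ [a Aa <-]; exact: h. Qed.

Lemma rdist_lt x r : rdist x < r -> exists2 a, A a & enorm (x - a) < r.
Proof. by case/inf_lt => // _ [a Aa <-] h; exists a. Qed.

Lemma rdist_lipschitz x y : rdist x <= rdist y + enorm (x - y).
Proof.
rewrite -lerBlDr; apply: le_rdist => a Aa; rewrite lerBlDr addrC.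
apply: le_trans (rdist_le x Aa) _; apply: le_trans (enormD _ _).
by rewrite addrA subrK.
Qed.

Lemma approx_convex_near x y (t e : R) : approx_convex A -> A x -> A y ->
  0 <= t <= 1 -> 1 < e ->
  exists2 a, A a & enorm (t *: x + (1 - t) *: y - a) < e.
Proof.
move=> hA Ax Ay ht e1; have := hA _ _ Ax Ay _ ht.
by rewrite edist_setE lee_fin => /le_lt_trans /(_ e1) /rdist_lt.
Qed.

End Distance.

(** * Convex combinations: iterated halving and Caratheodory reduction *)

Section ConvexCombinations.
Variables (R : realType) (n : nat) (A : set 'rV[R]_n).
Hypothesis A0 : A !=set0.
Hypothesis hA : approx_convex A.

(* The weights are left unnormalised so that a half of the combination with
   total weight [0] needs no separate treatment. *)
Lemma dyadic_combination (k : nat) (e : R) (m : nat) (w : 'I_m -> R)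
    (p : 'I_m -> 'rV[R]_n) :
  (m <= 2 ^ k)%N -> k%:R < e -> (forall i, 0 <= w i) -> (forall i, A (p i)) ->
  exists2 a, A a & enorm (\sum_(i < m) w i *: p i - (\sum_(i < m) w i) *: a) <=
                   (\sum_(i < m) w i) * e.
Proof.
elim: k e m w p => [|k IH] e m w p hm he w0 Ap.
  have [a0 Aa0] := A0.
  case: m w p hm w0 Ap => [|[|//]] w p _ w0 Ap.
    by exists a0 => //; rewrite !big_ord0 scale0r subr0 enorm0 mul0r.
  exists (p ord0) => //; rewrite !big_ord1 subrr enorm0 mulr_ge0 //.
  exact: ltW.
have [m1 [m2 [em hm1 hm2]]] :
    exists m1 m2, [/\ m = (m1 + m2)%N, (m1 <= 2 ^ k)%N & (m2 <= 2 ^ k)%N].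
  exists (minn m (2 ^ k)), (m - 2 ^ k)%N.
  by move: hm; rewrite expnS => hm; split; lia.
subst m; rewrite !big_split_ord /=.
(* Midpoint of [k] and [e - 1]: the slack of [e] over [k + 1] is shared between the two halves and
   the final merging of [a1] and [a2]. *)
pose e' := (k%:R + e - 1) / 2.
have ke : k%:R + 1 < e by rewrite natr1.
have e'k : k%:R < e' by rewrite /e'; lra.
have e1 : 1 < e - e' by rewrite /e'; lra.
have [a1 Aa1 h1] := IH e' m1 (fun i => w (lshift m2 i))
  (fun i => p (lshift m2 i)) hm1 e'k (fun=> w0 _) (fun=> Ap _).
have [a2 Aa2 h2] := IH e' m2 (fun i => w (rshift m1 i))
  (fun i => p (rshift m1 i)) hm2 e'k (fun=> w0 _) (fun=> Ap _).
set x1 := \sum_(i < m1) _ *: _ in h1 *.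
set x2 := \sum_(i < m2) _ *: _ in h2 *.
set t := \sum_(i < m1) _ in h1 *; set s := \sum_(i < m2) _ in h2 *.
have t0 : 0 <= t by apply: sumr_ge0.
have s0 : 0 <= s by apply: sumr_ge0.
have [a Aa ha] : exists2 a, A a &
    enorm (t *: a1 + s *: a2 - (t + s) *: a) <= (t + s) * (e - e').
  have [ts0|ts0] := eqVneq (t + s) 0.
    have [-> ->] : t = 0 /\ s = 0 by split; lra.
    by exists a1 => //; rewrite addr0 !scale0r addr0 subr0 enorm0 mul0r.
  have ts : 0 < t + s by rewrite lt0r ts0 addr_ge0.
  have [|a Aa ha] := approx_convex_near A0 (t := t / (t + s)) hA Aa1 Aa2 _ e1.
    by rewrite divr_ge0 ?(ltW ts) //= ler_pdivrMr // mul1r lerDl.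
  exists a => //.
  have -> : t *: a1 + s *: a2 - (t + s) *: a =
      (t + s) *: ((t / (t + s)) *: a1 + (1 - t / (t + s)) *: a2 - a).
    rewrite scalerBr scalerDr !scalerA; congr (_ *: _ + _ *: _ - _); field => //.
  by rewrite enormZ gtr0_norm // ler_pM2l // ltW.
exists a => //.
have -> : x1 + x2 - (t + s) *: a = (x1 - t *: a1) + (x2 - s *: a2) +
    (t *: a1 + s *: a2 - (t + s) *: a).
  by apply/rowP => i; rewrite !mxE; ring.
apply: le_trans (enormD _ _) _.
have := enormD (x1 - t *: a1) (x2 - s *: a2).
by move: h1 h2 ha; rewrite !mulrDl !mulrDr !mulrN; lra.
Qed.

Definition conv_comb (m : nat) (x : 'rV[R]_n) : Prop :=
  exists (w : 'I_m -> R) (p : 'I_m -> 'rV[R]_n),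
     (forall i, 0 <= w i) /\ \sum_(i < m) w i = 1 /\
     (forall i, A (p i)) /\ x = \sum_(i < m) w i *: p i.

Lemma rdist_dyadic (k m : nat) x : (m <= 2 ^ k)%N -> conv_comb m x ->
  rdist A x <= k%:R.
Proof.
move=> hm [w [p [w0 [w1 [Ap ->]]]]].
apply/ler_addgt0Pr => e e0.
have ke : k%:R < k%:R + e by rewrite ltrDl.
have [a Aa] := dyadic_combination hm ke w0 Ap.
by rewrite w1 scale1r mul1r; apply: le_trans; exact: rdist_le.
Qed.

Lemma conv_comb_drop (m : nat) (w : 'I_m.+1 -> R) (p : 'I_m.+1 -> 'rV[R]_n) j :
  (forall i, 0 <= w i) -> \sum_(i < m.+1) w i = 1 -> (forall i, A (p i)) ->
  w j = 0 -> conv_comb m (\sum_(i < m.+1) w i *: p i).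
Proof.
move=> w0 w1 Ap wj; exists (w \o lift j), (p \o lift j); split=> [i|] /=.
  exact: w0.
split; first by rewrite -w1 (bigD1_ord j) //= wj add0r.
by split=> [i|] //; rewrite (bigD1_ord j) //= wj scale0r add0r.
Qed.

(** Homogeneous coordinates: the rows are linearly independent exactly when the points are affinely
    independent. *)
Definition affine_mx (m : nat) (p : 'I_m -> 'rV[R]_n) : 'M[R]_(m, 1 + n) :=
  row_mx (const_mx 1) (\matrix_i p i).

Lemma mul_affine_mx (m : nat) (p : 'I_m -> 'rV[R]_n) (c : 'rV[R]_m) :
  c *m affine_mx p =
  row_mx (\sum_(i < m) c ord0 i)%:M (\sum_(i < m) c ord0 i *: p i).
Proof.
rewrite /affine_mx mul_mx_row; congr row_mx.
  apply/matrixP => i j; rewrite !ord1 !mxE /=.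
  by apply: eq_bigr => l _; rewrite mxE mulr1.
by rewrite mulmx_sum_row; apply: eq_bigr => i _; rewrite rowK.
Qed.

(** Caratheodory's step: a kernel vector [c] is an affine dependency of the points, and subtracting
    a suitable multiple of it from the weights makes one of them vanish. *)
Lemma conv_comb_reduce (m : nat) (w : 'I_m.+1 -> R)
    (p : 'I_m.+1 -> 'rV[R]_n) :
  (forall i, 0 <= w i) -> \sum_(i < m.+1) w i = 1 -> (forall i, A (p i)) ->
  ~~ row_free (affine_mx p) -> conv_comb m (\sum_(i < m.+1) w i *: p i).
Proof.
move=> w0 w1 Ap; rewrite -kermx_eq0 => /rowV0Pn[c /sub_kermxP hc c0].
move: hc; rewrite mul_affine_mx -[RHS]row_mx0 => /eq_row_mx[/matrixP/(_ 0 0)].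
rewrite !mxE /= mulr1n => csum cp.
have [i0 ci0] : exists i, 0 < c ord0 i.
  apply: contrapT => h.
  have hle i : c ord0 i <= 0 by rewrite leNgt; apply/negP => hi; apply: h; exists i.
  move/eqP: c0; apply; apply/rowP => i; rewrite mxE; apply/eqP.
  rewrite -oppr_eq0; apply/eqP.
  have := @psumr_eq0P _ _ xpredT (fun i => - c ord0 i).
  by apply=> // [j _|]; rewrite ?oppr_ge0 // sumrN csum oppr0.
(* The least ratio [w i / c i] over positive [c i] is the largest multiple of [c] that keeps all
   weights nonnegative; it cancels the weight at [j]. *)
case: (@Order.TotalTheory.arg_minP _ R _ i0 (fun i => 0 < c ord0 i)
  (fun i => w i / c ord0 i) ci0) => j cj hj.
pose w' i := w i - w j / c ord0 j * c ord0 i.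
have -> : \sum_(i < m.+1) w i *: p i = \sum_(i < m.+1) w' i *: p i.
  under [RHS]eq_bigr do rewrite scalerBl -scalerA.
  by rewrite sumrB -scaler_sumr cp scaler0 subr0.
apply: (@conv_comb_drop _ _ _ j) => // [i||].
- rewrite subr_ge0; have [ci|ci] := ltP 0 (c ord0 i).
    by rewrite -ler_pdivlMr // hj.
  apply: le_trans (w0 i); rewrite -oppr_ge0 -mulrN mulr_ge0 ?oppr_ge0 //.
  by rewrite divr_ge0 // ltW.
- by rewrite sumrB -mulr_sumr csum mulr0 subr0.
- by rewrite /w' divfK ?subrr // gt_eqF.
Qed.

End ConvexCombinations.

(** * Upper bound: local maxima of the distance, and maximisation over a simplex *)

Section UpperBound.
Variables (R : realType) (n : nat) (A : set 'rV[R]_n).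
Hypothesis A0 : A !=set0.
Hypothesis hA : approx_convex A.

(* Moving away from an almost nearest point [a] of [A] produces another almost
   nearest point [b] with an obtuse angle [a y b], so the midpoint of [a] and [b]
   is at distance about [rdist A y / sqrt 2] from [y]. *)
Lemma rdist_local_max_le4 (y : 'rV[R]_n) :
  (forall (u : 'rV[R]_n) (d : R), 0 < d ->
     exists2 e : R, 0 < e < d & rdist A (y + e *: u) <= rdist A y) ->
  rdist A y <= 4.
Proof.
move=> hmax; rewrite leNgt; apply/negP => r4.
set r := rdist A y in hmax r4 *.
have [a Aa ha] : exists2 a, A a & enorm (y - a) < r + 1/10.
  by apply: rdist_lt => //; rewrite ltrDl.
have ra : r <= enorm (y - a) by exact: rdist_le.
(* As [enorm (y - a) < r + 1], this bound makes the displacement shorter than 1/20. *)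
have d0 : 0 < 1 / (20 * (r + 1)) by rewrite divr_gt0 // mulr_gt0 //; lra.
have [e /andP[e0 ed] he] := hmax (y - a) _ d0.
set u := y - a in ha ra he *.
have eu0 : 0 < e * enorm u by rewrite mulr_gt0 //; lra.
have eu : e * enorm u < 1 / 20.
  have : e * (20 * (r + 1)) < 1.
    by rewrite -ltr_pdivlMr // mulr_gt0 //; lra.
  by nra.
(* With this threshold the term [(e * enorm u) ^+ 2] cancels when the square of
   [enorm (y + e *: u - b)] is expanded, leaving the sign of [dotv u (y - b)]. *)
pose q := Num.sqrt (r ^+ 2 + (e * enorm u) ^+ 2).
have q0 : 0 <= q by exact: sqrtr_ge0.
have q2 : q ^+ 2 = r ^+ 2 + (e * enorm u) ^+ 2.
  by rewrite sqr_sqrtr // addr_ge0 ?sqr_ge0.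
have rq : r < q by nra.
have qr : q <= r + e * enorm u by nra.
have [b Ab hb] := rdist_lt A0 (le_lt_trans he rq).
have rb : r <= enorm (y - b) by exact: rdist_le.
have hb0 := enorm_ge0 (y + e *: u - b).
have hb1 : enorm (y + e *: u - b) ^+ 2 < q ^+ 2 by nra.
have rb2 : r ^+ 2 <= enorm (y - b) ^+ 2 by nra.
have uneg : dotv u (y - b) <= 0.
  move: hb1 rb2; rewrite q2 addrAC !sqr_enorm !(dotvDl _ (e *: u)).
  rewrite !(dotvDr _ _ (e *: u)) !dotvZl !dotvZr (dotvC _ u).
  rewrite exprMn sqr_enorm => h1 h2.
  by nra.
have hyb : enorm (y - b) < r + 1/10.
  have -> : y - b = (y + e *: u - b) + - (e *: u).
    by apply/rowP => i; rewrite !mxE; ring.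
  apply: le_lt_trans (enormD _ _) _.
  by rewrite enormN enormZ gtr0_norm //; lra.
have [||c Ac hc] := approx_convex_near A0 (t := 1/2) (e := 1 + 1/100) hA Aa Ab.
- by apply/andP; split; lra.
- by lra.
set z := _ *: a + _ in hc.
have yz : y - z = (1/2) *: (u + (y - b)).
  by apply/rowP => i; rewrite !mxE; field.
have hz2 : enorm (y - z) ^+ 2 <= (r + 1/10) ^+ 2 / 2.
  rewrite yz sqr_enorm dotvZl dotvZr dotvDl !(dotvDr _ u) (dotvC _ u).
  rewrite -!sqr_enorm; have := enorm_ge0 u; have := enorm_ge0 (y - b).
  by nra.
have hz : r <= enorm (y - z) + enorm (z - c).
  apply: le_trans (rdist_le y Ac) _; apply: le_trans (enormD _ _).
  by rewrite addrA subrK.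
(* Here [r] is at most (r + 1/10) / sqrt 2 + 1 + 1/100, which forces r < 3.7. *)
have := enorm_ge0 (y - z).
by nra.
Qed.

Definition simplex (m : nat) : set 'rV[R]_m :=
  [set w | (forall i, 0 <= w ord0 i) /\ \sum_(i < m) w ord0 i = 1].

Lemma coord_le_mx_norm m (v : 'rV[R]_m) i : `|v ord0 i| <= `|v|.
Proof.
have -> : `|v| = mx_norm v by [].
rewrite mx_normrE.
exact: (le_bigmax _ (fun ij : 'I_1 * 'I_m => `|v ij.1 ij.2|) (ord0, i)).
Qed.

Lemma compact_simplex m : compact (@simplex m).
Proof.
have hcube := @rV_compact R m (fun=> `[0, 1]%classic) (fun=> @segment_compact R 0 1).
apply: subclosed_compact hcube _.
- have -> : @simplex m =
      (\bigcap_(i in [set: 'I_m])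
         ((fun w : 'rV[R]_m => w ord0 i) @^-1` [set x | 0 <= x])) `&`
      ((fun w : 'rV[R]_m => \sum_(i < m) w ord0 i) @^-1` [set x | x = 1]).
    by apply/seteqP; split => w /= [h1 h2]; split=> // i; [move=> _|]; exact: h1.
  apply: closedI.
    apply: closed_bigI => i _; apply: closed_comp; last exact: closed_ge.
    by move=> w _; exact: coord_continuous.
  apply: closed_comp; last exact: closed_eq.
  have csum : continuous (fun w : 'rV[R]_m => \sum_(i < m) w ord0 i).
    apply: (continuous_big (op := +%R)) => [|i _]; first exact: add_continuous.
    exact: coord_continuous.
  by move=> w _; exact: csum.
- move=> w [w0 w1] i /=; rewrite in_itv /= w0 /= -w1 (bigD1 i) //= lerDl.
  by apply: sumr_ge0.
Qed.

Lemma rdist_comb_continuous m (p : 'I_m -> 'rV[R]_n) :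
  continuous (fun w : 'rV[R]_m => rdist A (\sum_(i < m) w ord0 i *: p i)).
Proof.
pose C : R := \sum_(i < m) enorm (p i) + 1.
have C0 : 0 < C by rewrite ltr_wpDl // sumr_ge0 // => i _; exact: enorm_ge0.
have lip (v w : 'rV[R]_m) : rdist A (\sum_(i < m) v ord0 i *: p i) <=
    rdist A (\sum_(i < m) w ord0 i *: p i) + `|v - w| * C.
  apply: le_trans (rdist_lipschitz A0 _ (\sum_(i < m) w ord0 i *: p i)) _.
  rewrite lerD2l -sumrB; apply: le_trans (enorm_sum _) _.
  rewrite mulrDr mulr1 mulr_sumr; apply: ler_wpDr => //.
  apply: ler_sum => i _; rewrite -scalerBl enormZ ler_wpM2r ?enorm_ge0 //.
  have -> : v ord0 i - w ord0 i = (v - w) ord0 i by rewrite !mxE.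
  exact: coord_le_mx_norm.
move=> w; apply/(@cvgrPdist_le _ _ _ (nbhs w) (nbhs_filter w)) => e e0; near=> v.
have h : `|w - v| * C <= e.
  rewrite -ler_pdivlMr //; apply: ltW.
  have : ball w (e / C) v by near: v; apply: nbhsx_ballx; exact: divr_gt0.
  by rewrite -ball_normE.
have := lip v w; have := lip w v; rewrite (distrC v w) ler_norml; lra.
Unshelve. all: by end_near. Qed.

Lemma rdist_conv_comb (k m : nat) x :
  (4 <= k)%N -> (n <= 2 ^ k)%N -> conv_comb A m x -> rdist A x <= k%:R.
Proof.
move=> k4 nk; elim: m x => [|m IH] x hx.
  exact: rdist_dyadic hx.
have [mk|mk] := leqP m.+1 (2 ^ k); first exact: rdist_dyadic hx.
case: hx => w [p [w0 [w1 [Ap ->]]]].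
have [hfree|hfree] := boolP (row_free (affine_mx p)); last first.
  by apply: IH; exact: conv_comb_reduce.
(* More than [2 ^ k >= n] points, yet at most [n + 1] by affine independence. *)
have emn : m = n.
  apply/eqP; rewrite eqn_leq (leq_trans nk mk) andbT -ltnS.
  by have := rank_leq_col (affine_mx p); rewrite (eqP hfree).
subst m.
pose f (v : 'rV[R]_n.+1) := rdist A (\sum_(i < n.+1) v ord0 i *: p i).
have [|||v /set_mem[v0 v1] vmax] := @EVT_max_rV R n.+1 f (@simplex n.+1).
- exists (\row_i w i); split=> [i|]; first by rewrite mxE.
  by rewrite -w1; apply: eq_bigr => i _; rewrite mxE.
- exact: compact_simplex.
- by apply: continuous_subspaceT; exact: rdist_comb_continuous.
have -> : \sum_(i < n.+1) w i *: p i = \sum_(i < n.+1) (\row_i w i) ord0 i *: p i.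
  by apply: eq_bigr => i _; rewrite mxE.
apply: (@le_trans _ _ (f v)).
  apply: vmax; apply/mem_set; split=> [i|]; first by rewrite mxE.
  by rewrite -w1; apply: eq_bigr => i _; rewrite mxE.
(* A maximum on the boundary uses one point fewer, so induction applies; otherwise all weights at
   [v] are positive. *)
have [[j vj]|vpos] := pselect (exists j, v ord0 j = 0).
  by apply: IH; exact: (conv_comb_drop v0 v1 Ap vj).
apply: (@le_trans _ _ 4); last by rewrite ler_nat.
apply: rdist_local_max_le4 => u d d0.
have Bunit : affine_mx p \in unitmx by rewrite -row_free_unit.
(* The simplex is full-dimensional, so any direction [u] comes from a change [c] of barycentric
   coordinates with zero sum. *)
have [c cB] : exists c : 'rV[R]_n.+1, c *m affine_mx p = row_mx (0 : 'rV[R]_1) u.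
  exists ((row_mx (0 : 'rV[R]_1) u : 'rV[R]_n.+1) *m invmx (affine_mx p)).
  exact: mulmxKV.
have := mul_affine_mx p c; rewrite cB => /eq_row_mx[/matrixP/(_ 0 0)].
rewrite !mxE /= mulr1n => csum cu.
have vgt0 i : 0 < v ord0 i.
  by rewrite lt0r v0 andbT; apply/eqP => vi; apply: vpos; exists i.
pose mu := \big[Num.min/1]_(i < n.+1) v ord0 i.
have mu0 : 0 < mu by apply: lt_bigmin.
have muv i : mu <= v ord0 i by exact: bigmin_le.
pose C := \sum_(i < n.+1) `|c ord0 i| + 1.
have C0 : 0 < C by rewrite ltr_wpDl // sumr_ge0.
have cC i : `|c ord0 i| <= C.
  by rewrite /C (bigD1 i) //= -addrA lerDl addr_ge0 // sumr_ge0.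
(* The bound [mu / C] keeps the weights [v + e *: c] nonnegative, since [C] dominates every [c i]
   and [mu] is below every [v i]. *)
pose e := Num.min (d / 2) (mu / C).
have e0 : 0 < e by rewrite lt_min !divr_gt0.
exists e.
  by rewrite e0 /= gt_min; apply/orP; left; lra.
have eC : e * C <= mu by rewrite -ler_pdivlMr // ge_min lexx orbT.
rewrite [X in rdist A X](_ : _ = \sum_(i < n.+1) (v + e *: c) ord0 i *: p i).
  apply: vmax; apply/mem_set; split=> [i|]; last first.
    under eq_bigr do rewrite !mxE.
    by rewrite big_split /= v1 -mulr_sumr -csum mulr0 addr0.
  rewrite !mxE; have := muv i; have := cC i; rewrite ler_norml => /andP[h1 h2] h3.
  by nra.
rewrite cu scaler_sumr -big_split /=; apply: eq_bigr => i _.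
by rewrite !mxE scalerDl scalerA.
Qed.

End UpperBound.

(** * Entropy on the simplex, in natural logarithms *)

Section Entropy.
Variable R : realType.
Implicit Types t u v c : R.

Definition nxlnx u : R := - (u * ln u).

Lemma ln_le_subr1 u : 0 < u -> ln u <= u - 1.
Proof.
move=> u0; have {1}-> : u = 1 + (u - 1) by ring.
by apply: le_ln1Dx; lra.
Qed.

Lemma nxlnx0 : nxlnx 0 = 0.
Proof. by rewrite /nxlnx mul0r oppr0. Qed.

Lemma nxlnx_ge0 u : 0 <= u <= 1 -> 0 <= nxlnx u.
Proof. by case/andP=> u0 u1; rewrite oppr_ge0 mulr_ge0_le0 // ln_le0. Qed.

Lemma nxlnxD u v : 0 <= u -> 0 <= v -> nxlnx (u + v) <= nxlnx u + nxlnx v.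
Proof.
rewrite le_eqVlt => /predU1P[<- _|u0]; first by rewrite nxlnx0 !add0r.
rewrite le_eqVlt => /predU1P[<-|v0]; first by rewrite nxlnx0 !addr0.
have uv : 0 < u + v by exact: addr_gt0.
have h1 : ln u <= ln (u + v) by rewrite ler_ln ?posrE // lerDl ltW.
have h2 : ln v <= ln (u + v) by rewrite ler_ln ?posrE // lerDr ltW.
have := ler_wpM2l (ltW u0) h1; have := ler_wpM2l (ltW v0) h2.
by rewrite /nxlnx mulrDl; lra.
Qed.

Lemma nxlnxM u v : 0 <= u -> 0 <= v ->
  nxlnx (u * v) = u * nxlnx v + v * nxlnx u.
Proof.
rewrite le_eqVlt => /predU1P[<- _|u0]; first by rewrite nxlnx0 !mul0r nxlnx0 mulr0 addr0.
rewrite le_eqVlt => /predU1P[<-|v0]; first by rewrite nxlnx0 !(mulr0, mul0r) nxlnx0 addr0.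
by rewrite /nxlnx lnM ?posrE //; ring.
Qed.

(** Concavity: the right side is the tangent at [c]. *)
Lemma nxlnx_le_tangent c u : 0 < c -> 0 <= u ->
  nxlnx u <= c - u - u * ln c.
Proof.
move=> c0; rewrite le_eqVlt => /predU1P[<-|u0].
  by rewrite nxlnx0 mul0r !subr0 ltW.
have := ln_le_subr1 (divr_gt0 c0 u0); rewrite ln_div ?posrE // => h.
have cu : c / u * u = c by rewrite divfK // gt_eqF.
by rewrite /nxlnx; nra.
Qed.

(** The left side is the parabola through the origin that is tangent to the graph at [c]; it comes
    from [ln (u / c) <= u / c - 1]. *)
Lemma nxlnx_ge_secant c u : 0 < c -> 0 <= u ->
  u * (1 - u / c - ln c) <= nxlnx u.
Proof.
move=> c0; rewrite le_eqVlt => /predU1P[<-|u0].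
  by rewrite nxlnx0 mul0r.
have := ln_le_subr1 (divr_gt0 u0 c0); rewrite ln_div ?posrE // => h.
have := ler_wpM2l (ltW u0) h.
by rewrite /nxlnx; lra.
Qed.

Lemma nxlnx_binary t : 0 <= t <= 1 -> nxlnx t + nxlnx (1 - t) <= ln 2.
Proof.
case/andP=> t0 t1.
(* The tangent at 1/2, evaluated at [t] and at [1 - t], sums to exactly [ln 2]. *)
have h0 : (0 : R) < 2^-1 by [].
have := nxlnx_le_tangent h0 t0.
have := @nxlnx_le_tangent _ (1 - t) h0; rewrite subr_ge0 => /(_ t1).
by rewrite lnV ?posrE //; lra.
Qed.

Definition entropy n (x : 'rV[R]_n) : R := \sum_(i < n) nxlnx (x ord0 i).

Lemma entropy_ge0 n (x : 'rV[R]_n) : simplex x -> 0 <= entropy x.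
Proof.
move=> [x0 x1]; apply: sumr_ge0 => i _; apply: nxlnx_ge0; rewrite x0 /=.
by rewrite -x1 (bigD1 i) //= lerDl sumr_ge0.
Qed.

(** Subadditivity and the product rule for [nxlnx], applied in each coordinate, leave as excess the
    binary entropy of [t], because the coordinates of [x] and of [y] sum to 1. *)
Lemma entropy_comb n t (x y : 'rV[R]_n) : 0 <= t <= 1 ->
  simplex x -> simplex y ->
  entropy (t *: x + (1 - t) *: y) <=
    t * entropy x + (1 - t) * entropy y + ln 2.
Proof.
move=> ht [x0 x1] [y0 y1]; have /andP[t0 t1] := ht.
have s0 : 0 <= 1 - t by rewrite subr_ge0.
apply: le_trans (lerD (lexx _) (nxlnx_binary ht)).
have -> : nxlnx t = \sum_(i < n) x ord0 i * nxlnx t.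
  by rewrite -mulr_suml x1 mul1r.
have -> : nxlnx (1 - t) = \sum_(i < n) y ord0 i * nxlnx (1 - t).
  by rewrite -mulr_suml y1 mul1r.
rewrite /entropy !mulr_sumr -!big_split /=; apply: ler_sum => i _.
rewrite !mxE; apply: le_trans (nxlnxD _ _) _; rewrite ?mulr_ge0 //.
by rewrite !nxlnxM //; lra.
Qed.

Lemma simplex_comb n t (x y : 'rV[R]_n) : 0 <= t <= 1 ->
  simplex x -> simplex y -> simplex (t *: x + (1 - t) *: y).
Proof.
case/andP=> t0 t1 [x0 x1] [y0 y1]; split=> [i|].
  by rewrite !mxE addr_ge0 // mulr_ge0 // subr_ge0.
under eq_bigr do rewrite !mxE.
by rewrite big_split /= -!mulr_sumr x1 y1; ring.
Qed.

(** Sum of the parabolas tangent at [n.+1%:R^-1]; the linear terms are constant on the simplex, and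
    the quadratic ones give the squared distance to the barycenter. *)
Lemma entropy_ge_barycenter n (x : 'rV[R]_n.+1) : simplex x ->
  ln n.+1%:R - n.+1%:R * enorm (const_mx n.+1%:R^-1 - x) ^+ 2 <= entropy x.
Proof.
move=> [x0 x1]; have n0 : 0 < n.+1%:R^-1 :> R by rewrite invr_gt0.
apply: le_trans (ler_sum _ (fun i _ => nxlnx_ge_secant n0 (x0 i))).
have -> : \sum_(i < n.+1) x ord0 i * (1 - x ord0 i / n.+1%:R^-1 - ln n.+1%:R^-1) =
    1 + ln n.+1%:R - n.+1%:R * dotv x x.
  rewrite lnV ?posrE // invrK opprK /dotv mulr_sumr.
  transitivity (\sum_(i < n.+1) (x ord0 i * (1 + ln n.+1%:R) -
     n.+1%:R * (x ord0 i * x ord0 i))).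
    by apply: eq_bigr => i _; ring.
  by rewrite sumrB -mulr_suml x1 mul1r.
rewrite sqr_enorm.
have -> : dotv (const_mx n.+1%:R^-1 - x) (const_mx n.+1%:R^-1 - x) =
    dotv x x - n.+1%:R^-1.
  transitivity (\sum_(i < n.+1) (x ord0 i * x ord0 i -
     2 * n.+1%:R^-1 * x ord0 i + n.+1%:R^-1 ^+ 2)).
    by apply: eq_bigr => i _; rewrite !mxE; ring.
  rewrite big_split sumrB -mulr_sumr x1 sumr_const card_ord.
  rewrite -[_ ^+ 2 *+ _]mulr_natr mulr1 /=.
  have : n.+1%:R != 0 :> R by rewrite pnatr_eq0.
  by rewrite /dotv; move: n.+1%:R => N N0; field.
by rewrite mulrBr mulfV ?pnatr_eq0 //; lra.
Qed.

End Entropy.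

(** * Lower bound: the dilated entropy epigraph *)

Section LowerBound.
Variables (R : realType) (n : nat).
Let N : R := n.+1%:R.

Definition diag_unit : 'rV[R]_n.+1 := const_mx (Num.sqrt N)^-1.

Lemma dotv_diag_unit (x : 'rV[R]_n.+1) :
  dotv x diag_unit = (\sum_(i < n.+1) x ord0 i) / Num.sqrt N.
Proof. by rewrite mulr_suml; apply: eq_bigr => i _; rewrite mxE. Qed.

Lemma dotv_diag_unit1 : dotv diag_unit diag_unit = 1.
Proof.
rewrite dotv_diag_unit; under eq_bigr do rewrite mxE.
have N0 : 0 < N by rewrite ltr0n.
rewrite sumr_const card_ord -mulr_natl -mulrA -expr2 exprVn.
by rewrite sqr_sqrtr ?mulfV ?gt_eqF // ltW.
Qed.

(* The epigraph of the base 2 entropy over the simplex dilated by [M], the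
   vertical axis being the normal of the hyperplane spanned by the simplex. *)
Definition entropy_epigraph (M : R) : set 'rV[R]_n.+1 :=
  [set v | exists (x : 'rV[R]_n.+1) (s : R),
     simplex x /\ entropy x <= s * ln 2 /\ v = M *: x + s *: diag_unit].

Lemma simplex_delta (i : 'I_n.+1) : simplex (delta_mx ord0 i : 'rV[R]_n.+1).
Proof.
split=> [j|]; first by rewrite mxE eqxx /=; case: (_ == _).
rewrite (bigD1 i) //= mxE !eqxx big1 ?addr0 // => j ji.
by rewrite mxE eqxx (negbTE ji).
Qed.

Lemma entropy_epigraph_vertex (M : R) i :
  entropy_epigraph M (M *: delta_mx ord0 i).
Proof.
exists (delta_mx ord0 i), 0; split; first exact: simplex_delta.
split; last by rewrite scale0r addr0.
rewrite mul0r /entropy big1 // => j _; rewrite mxE eqxx /=.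
by case: (_ == _); rewrite /nxlnx ?ln1 ?mulr0 ?mul0r oppr0.
Qed.

Lemma entropy_epigraph_neq0 (M : R) : entropy_epigraph M !=set0.
Proof. by exists (M *: delta_mx ord0 ord0); exact: entropy_epigraph_vertex. Qed.

(** The excess [ln 2] in [entropy_comb] is one unit of height, so raising the combination by
    [diag_unit], of norm 1, puts it in the epigraph. *)
Lemma approx_convex_entropy_epigraph (M : R) :
  approx_convex (entropy_epigraph M).
Proof.
move=> v1 v2 [x [s [hx [hs ->]]]] [y [r [hy [hr ->]]]] t ht.
rewrite (edist_setE (entropy_epigraph_neq0 M)) lee_fin.
pose q := t * s + (1 - t) * r.
have := @rdist_le R _ (entropy_epigraph M)
  (t *: (M *: x + s *: diag_unit) + (1 - t) *: (M *: y + r *: diag_unit))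
  (M *: (t *: x + (1 - t) *: y) + (q + 1) *: diag_unit).
have -> : t *: (M *: x + s *: diag_unit) + (1 - t) *: (M *: y + r *: diag_unit)
   - (M *: (t *: x + (1 - t) *: y) + (q + 1) *: diag_unit) = - diag_unit.
  by apply/rowP => i; rewrite /q !mxE; ring.
have -> : enorm (- diag_unit) = 1.
  apply/eqP; rewrite -(@eqrXn2 _ 2) ?enorm_ge0 //.
  by rewrite enormN sqr_enorm dotv_diag_unit1 expr1n.
apply; exists (t *: x + (1 - t) *: y), (q + 1).
split; first exact: simplex_comb.
split=> //; apply: le_trans (entropy_comb ht hx hy) _.
have /andP[t0 t1] := ht; rewrite /q.
have := ler_wpM2l t0 hs.
have : 0 <= 1 - t by rewrite subr_ge0.
by move=> /ler_wpM2l /(_ _ _ hr); lra.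
Qed.

(** The vertices have entropy 0, so the epigraph contains them at height 0, and the barycenter is
    their mean. *)
Lemma conv_hull_barycenter (M : R) :
  conv_hull (entropy_epigraph M) (M *: const_mx N^-1).
Proof.
exists n.+1, (fun=> N^-1), (fun i => M *: delta_mx ord0 i).
split; first by move=> _; rewrite invr_ge0.
split; first by rewrite sumr_const card_ord -mulr_natl mulfV // pnatr_eq0.
split; first exact: entropy_epigraph_vertex.
under eq_bigr do rewrite scalerA mulrC -scalerA.
rewrite -scaler_sumr; congr (_ *: _).
by rewrite [LHS]row_sum_delta; apply: eq_bigr => i _; rewrite mxE.
Qed.

Lemma rdist_barycenter (M : R) : 2 * (ln N / ln 2) * (N / ln 2) <= M ^+ 2 ->
  ln N / ln 2 <= rdist (entropy_epigraph M) (M *: const_mx N^-1).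
Proof.
move=> hM; apply: (le_rdist (entropy_epigraph_neq0 M)) => _ [x [s [hx [hs ->]]]].
have L0 : 0 < ln 2 :> R by rewrite ln_gt0 // ltr1n.
have h := entropy_ge_barycenter hx; have hE := entropy_ge0 hx.
rewrite -/N in h.
set k := ln N / ln 2 in hM *; set c := N / ln 2 in hM.
set b : 'rV[R]_n.+1 := const_mx N^-1 in h *.
have k0 : 0 <= k by rewrite divr_ge0 ?(ltW L0) // ln_ge0 // ler1n.
have s0 : 0 <= s by rewrite -(pmulr_lge0 _ L0) (le_trans hE).
set D := enorm (b - x) ^+ 2 in h *.
have D0 : 0 <= D by exact: sqr_ge0.
have c0 : 0 <= c by rewrite divr_ge0 // ltW.
have hks : k - c * D <= s.
  rewrite -(ler_pM2r L0) (le_trans _ hs) // (le_trans _ h) //.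
  by rewrite mulrBl (mulrAC c) !divfK // gt_eqF.
have -> : M *: b - (M *: x + s *: diag_unit) = M *: (b - x) - s *: diag_unit.
  by rewrite scalerBr opprD addrA.
have horth : dotv (b - x) diag_unit = 0.
  rewrite dotv_diag_unit; under eq_bigr do rewrite !mxE.
  case: hx => _ x1; rewrite sumrB x1 sumr_const card_ord -mulr_natl.
  by rewrite mulfV ?pnatr_eq0 // subrr mul0r.
rewrite -(@ler_pXn2r _ 2) ?nnegrE ?enorm_ge0 //.
rewrite sqr_enorm -scaleNr dotvDl !dotvDr !dotvZl !dotvZr.
rewrite (dotvC diag_unit) horth dotv_diag_unit1 -sqr_enorm -/D.
have hMD : 2 * k * c * D <= M ^+ 2 * D by rewrite ler_wpM2r.
(* The squared distance is [M ^+ 2 * D + s ^+ 2]. If [c * D <= k], then [s ^+ 2 >= (k - c * D) ^+ 2]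
   and the first term absorbs the loss [2 * k * c * D]; otherwise the first term alone is at least
   [2 * k ^+ 2]. *)
have [hk|hk] := leP (c * D) k; nra.
Qed.

End LowerBound.

(** * Both bounds combined *)

Theorem theorem3p2 (R : realType) (k : nat) :
  (4 <= k)%N ->
  Cconst R (2 ^ k) = (ln ((2 ^ k)%:R : R) / ln 2)%:E.
Proof.
move=> k4.
have L0 : 0 < ln 2 :> R by rewrite ln_gt0 // ltr1n.
have lnk : ln ((2 ^ k)%:R : R) / ln 2 = k%:R.
  by rewrite natrX lnXn // -[ln _ *+ _]mulr_natl mulfK // gt_eqF.
apply/eqP; rewrite eq_le; apply/andP; split.
  rewrite lnk; apply: ge_ereal_sup => _ [A [A0 hA] <-].
  have subA a : A a -> conv_hull A a.
    move=> Aa; exists 1%N, (fun=> 1), (fun=> a).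
    by rewrite !big_ord1 scale1r; do !split.
  rewrite ge_max; apply/andP; split; apply: ge_ereal_sup => _ [x Ax <-].
    rewrite edist_setE; last by exists x; exact: subA.
    rewrite lee_fin (le_trans (rdist_le x (subA _ Ax))) //.
    by rewrite subrr enorm0.
  rewrite (edist_setE A0) lee_fin; case: Ax => m hx.
  exact: (rdist_conv_comb A0 hA k4 (leqnn _) hx).
case E : (2 ^ k)%N => [|n]; first by have := expn_gt0 2 k; rewrite E.
set l := ln _ / _.
(* Least nonnegative dilation allowed by [rdist_barycenter]. *)
pose M : R := Num.sqrt (2 * l * (n.+1%:R / ln 2)).
have : (hausdorff (@entropy_epigraph R n M) (conv_hull (@entropy_epigraph R n M))
          <= Cconst R n.+1)%E.
  apply: ereal_sup_ubound; exists (@entropy_epigraph R n M) => //; split.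
    exact: entropy_epigraph_neq0.
  exact: approx_convex_entropy_epigraph.
apply: le_trans.
rewrite le_max; apply/orP; right; apply: ereal_sup_ge.
eexists; first by exists (M *: const_mx n.+1%:R^-1); [exact: conv_hull_barycenter|].
rewrite edist_setE ?lee_fin; last exact: entropy_epigraph_neq0.
apply: rdist_barycenter; rewrite sqr_sqrtr // !mulr_ge0 // ?invr_ge0 ?(ltW L0) //.
by rewrite ln_ge0 // ler1n.
Qed.
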